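(* Consider the action of $\tilde\Gamma_{\mathrm{pol}}$ by right multiplication on the set of primitive vectors of $\mathbb{Z}^{2g}$. A set of representatives for the orbits of this action (each orbit being represented exactly once) is given by the vectors $$\hat v=(D_{1:g-1},\,D_{2:g-1}a_2,\,D_{3:g-1}a_3,\dots,D_{g-1}a_{g-1},\,1,\,0,\dots,0)\in\mathbb{Z}^{2g}$$ (the entry $1$ being the $g$-th one), where $(D_1,\dots,D_{g-1})$ runs through all tuples of positive integers satisfying $D_i\mid d_i$ for all $i$ and $\gcd\big(\tfrac{d_i}{D_i},D_j\big)=1$ for all $1\le i<j\le g-1$, and where the $a_i\ge 0$ are integers with $$a_i\ \Big|\ \gcd\Big(D_{i-1}a_{i-1},\ \tfrac{d_i}{D_i}a_{i+1}\Big)\qquad\text{for } i=2,\dots,g-1,$$ where we let $a_1=a_g=1$. Here $D_{i:j}=\prod_{n=i}^{j}D_n$ for $i\le j$ and $D_{i:j}=1$ for $i>j$.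
   Context: Let $g$ be a positive integer and $d_1,\dots,d_{g-1}$ positive integers. Put $d_{i:j}=\prod_{n=i}^{j}d_n$ for $i\le j$ and $d_{i:j}=1$ for $i>j$. The polarisation type is $(1,d_1,d_{1:2},\dots,d_{1:g-1})$; let $\Delta=\operatorname{diag}(1,d_1,d_{1:2},\dots,d_{1:g-1})$ and $\Lambda=\begin{pmatrix}0&\Delta\\-\Delta&0\end{pmatrix}$. The group $$\tilde\Gamma_{\mathrm{pol}}=\{M\in \mathrm{SL}(2g,\mathbb{Z}): M\Lambda\,{}^tM=\Lambda\}$$ acts on row vectors by right multiplication. A vector of $\mathbb{Z}^{2g}$ is primitive if the gcd of its entries is $1$. (Each line in $\mathbb{Q}^{2g}$ is isotropic and spanned by a primitive vector.) *)

(* Defs.v *)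
From HB Require Import structures.
From mathcomp Require Import all_boot all_order all_algebra.

Set Implicit Arguments.
Unset Strict Implicit.
Unset Printing Implicit Defensive.

Import GRing.Theory Num.Theory.

Local Open Scope ring_scope.

(* Tuples (d_1, ..., d_(g-1)), (D_1, ..., D_(g-1)) and (a_1, ..., a_g) are    *)
(* functions [nat -> nat] with the index starting at 1; only the values at    *)
(* the indices displayed here are ever used.                                  *)

(* d_{i:j}; the range is empty, and the product 1, when j < i. *)
Definition prod_range (d : nat -> nat) (i j : nat) : nat :=
  (\prod_(i <= n < j.+1) d n)%N.

(* Ordinals of ['I_g] start at 0, so entry [i] is d_{1:i}, with d_{1:0} = 1. *)
Definition Delta_pol (g : nat) (d : nat -> nat) : 'M[int]_g :=
  diag_mx (\row_(i < g) (prod_range d 1 i)%:Z).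

Definition Lambda_pol (g : nat) (d : nat -> nat) : 'M[int]_(g + g) :=
  block_mx 0 (Delta_pol g d) (- Delta_pol g d) 0.

Definition Gamma_pol (g : nat) (d : nat -> nat) (M : 'M[int]_(g + g)) : Prop :=
  \det M = 1 /\ M *m Lambda_pol g d *m M^T = Lambda_pol g d.

Definition same_orbit (g : nat) (d : nat -> nat) (v w : 'rV[int]_(g + g)) :
    Prop :=
  exists2 M : 'M[int]_(g + g), Gamma_pol d M & w = v *m M.

Definition primitive_vec (n : nat) (v : 'rV[int]_n) : Prop :=
  \big[gcdn/0%N]_(j < n) absz (v 0 j) = 1%N.

Definition admissible (g : nat) (d D a : nat -> nat) : Prop :=
  [/\ forall i, (1 <= i < g)%N -> (0 < D i)%N /\ (D i %| d i)%N,
      forall i j, (1 <= i)%N -> (i < j)%N -> (j < g)%N ->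
        gcdn (d i %/ D i) (D j) = 1%N,
      a 1%N = 1%N /\ a g = 1%N
    & forall i, (2 <= i < g)%N ->
        (a i %| gcdn (D i.-1 * a i.-1) ((d i %/ D i) * a i.+1))%N].

(* The i-th of the first g entries (i = 1, ..., g) is D_{i:g-1} a_i; as       *)
(* a_1 = a_g = 1, the first one is D_{1:g-1} and the g-th one is 1.           *)
Definition hat_vec (g : nat) (D a : nat -> nat) : 'rV[int]_(g + g) :=
  row_mx (\row_(i < g) (prod_range D i.+1 g.-1 * a i.+1)%N%:Z) 0.

(* Main.v *)
Require Import Defs.
From mathcomp Require Import all_boot all_order all_algebra.

(* Write delta_i = d_{1:i-1}.  A matrix of the group can add any multiple of  *)
(* the i-th coordinate plane to the j-th one when i < j, but only multiples   *)
(* of (delta_i / delta_j) when i > j.  Hence the orbit of a vector with       *)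
(* plane-wise gcds x_1, ..., x_g determines the numbers                       *)
(*   t_i = gcd (x_k for k <= i, (delta_k / delta_i) x_k for k > i),           *)
(* and conversely the vector can be moved to (t_1, ..., t_g, 0, ..., 0).      *)
(* These t are characterised by t_{i+1} | t_i | d_i t_{i+1}, and t_g = 1 for  *)
(* primitive vectors.  Such a t is written uniquely as t_i = D_{i:g-1} a_i    *)
(* with (D, a) admissible: the coprimality condition amounts to               *)
(* D_i = gcd (d_i, D_{i:g-1}), so t_1 = D_{1:g-1} determines every D_i, and   *)
(* then t_i determines a_i.                                                   *)

Set Implicit Arguments.
Unset Strict Implicit.
Unset Printing Implicit Defensive.

Import GRing.Theory Num.Theory.

Local Open Scope ring_scope.

(** Existence is a descent: [same_orbit_gcd] turns each coordinate plane into (gcd, 0), and repeated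
    use of [same_orbit_pair], which replaces two entries by gcds, ends in a balanced vector
    ([same_orbit_balanced]). Uniqueness rests on the divisibility that the symplectic relation
    forces on the upper left block ([Gamma_pol_ul_dvd]): the entries of a balanced vector divide
    those of every [nat_vec] in its orbit ([balanced_orbit_dvd]), so two balanced vectors in one
    orbit agree. The rest is arithmetic: [admissible_chain], [admissible_exists] and
    [admissible_inj] match the chains t_{i+1} | t_i | d_i t_{i+1} with t_g = 1 to the admissible
    pairs (D, a). *)

(** * The group and its orbit relation *)

Lemma Gamma_pol1 g d : @Gamma_pol g d 1%:M.
Proof. by split; rewrite ?det1 // mul1mx trmx1 mulmx1. Qed.

Lemma Gamma_pol_unitmx g d (M : 'M[int]_(g + g)) : Gamma_pol d M -> M \in unitmx.
Proof. by case=> detM _; rewrite unitmxE detM unitr1. Qed.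

Lemma Gamma_polM g d (M N : 'M[int]_(g + g)) :
  Gamma_pol d M -> Gamma_pol d N -> Gamma_pol d (M *m N).
Proof.
move=> [dM sM] [dN sN]; split; first by rewrite det_mulmx dM dN mulr1.
by rewrite trmx_mul !mulmxA -!(mulmxA M) sN mulmxA.
Qed.

Lemma Gamma_polV g d (M : 'M[int]_(g + g)) :
  Gamma_pol d M -> Gamma_pol d (invmx M).
Proof.
move=> GM; have uM := Gamma_pol_unitmx GM; case: GM => dM sM.
split; first by rewrite det_inv dM invr1.
by rewrite -[in LHS]sM !mulmxA mulVmx // mul1mx -mulmxA -trmx_mul mulVmx //
  trmx1 mulmx1.
Qed.

Lemma same_orbit_refl g d (v : 'rV[int]_(g + g)) : same_orbit d v v.
Proof. by exists 1%:M; [exact: Gamma_pol1 | rewrite mulmx1]. Qed.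

Lemma same_orbit_sym g d (v w : 'rV[int]_(g + g)) :
  same_orbit d v w -> same_orbit d w v.
Proof.
move=> [M GM ->]; exists (invmx M); first exact: Gamma_polV.
by rewrite mulmxK // (Gamma_pol_unitmx GM).
Qed.

Lemma same_orbit_trans g d (u v w : 'rV[int]_(g + g)) :
  same_orbit d u v -> same_orbit d v w -> same_orbit d u w.
Proof.
move=> [M GM ->] [N GN ->]; exists (M *m N); first exact: Gamma_polM.
by rewrite mulmxA.
Qed.

(** * Explicit elements of the group *)

Lemma tr_Delta_pol g d : (Delta_pol g d)^T = Delta_pol g d.
Proof. by rewrite /Delta_pol tr_diag_mx. Qed.

Lemma same_orbit_ublock g d (x y : 'rV[int]_g) (B : 'M[int]_g) :
  (B *m Delta_pol g d)^T = B *m Delta_pol g d ->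
  same_orbit d (row_mx x y) (row_mx x (x *m B + y)).
Proof.
move=> symB; exists (block_mx 1%:M B 0 1%:M).
  split; first by rewrite det_ublock !det1 mulr1.
  rewrite tr_block_mx !mulmx_block !trmx1 !trmx0.
  rewrite !(mul1mx, mulmx1, mul0mx, mulmx0, addr0, add0r).
  by rewrite -[X in _ + X *m B^T]tr_Delta_pol -trmx_mul symB mulmxN addNr.
by rewrite mul_row_block !mulmx1 mulmx0 addr0.
Qed.

Lemma same_orbit_lblock g d (x y : 'rV[int]_g) (C : 'M[int]_g) :
  (C *m Delta_pol g d)^T = C *m Delta_pol g d ->
  same_orbit d (row_mx x y) (row_mx (x + y *m C) y).
Proof.
move=> symC; exists (block_mx 1%:M 0 C 1%:M).
  split; first by rewrite det_lblock !det1 mulr1.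
  rewrite tr_block_mx !mulmx_block !trmx1 !trmx0.
  rewrite !(mul1mx, mulmx1, mul0mx, mulmx0, addr0, add0r).
  by rewrite mulNmx -[X in - (X *m C^T)]tr_Delta_pol -trmx_mul symC addNr.
by rewrite mul_row_block !mulmx1 mulmx0 add0r.
Qed.

(* The entries of [s] are required to be nonzero only to compute the          *)
(* determinant by cancelling the one of [diag_mx s].                          *)
Lemma same_orbit_diag_block g d (x y p q r s : 'rV[int]_g) :
    (forall i, s 0 i != 0) ->
    (forall i, p 0 i * s 0 i - q 0 i * r 0 i = 1) ->
  same_orbit d (row_mx x y)
    (row_mx (\row_i (x 0 i * p 0 i + y 0 i * r 0 i))
            (\row_i (x 0 i * q 0 i + y 0 i * s 0 i))).
Proof.
move=> s_neq0 det_psqr.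
have diagC (a b : 'rV[int]_g) : diag_mx a *m diag_mx b = diag_mx b *m diag_mx a.
  by rewrite diag_mxC.
have psqr : diag_mx p *m diag_mx s - diag_mx q *m diag_mx r = 1%:M.
  rewrite !mulmx_diag -raddfB -diag_const_mx; congr diag_mx.
  by apply/rowP=> i; rewrite !mxE det_psqr.
exists (block_mx (diag_mx p) (diag_mx q) (diag_mx r) (diag_mx s)); last first.
  rewrite mul_row_block !mul_mx_diag; congr row_mx;
  by apply/rowP=> i; rewrite !mxE.
split.
  (* The product is block upper triangular with diagonal blocks 1 and [diag_mx s]. *)
  have : \det (block_mx (diag_mx p) (diag_mx q) (diag_mx r) (diag_mx s) *m
     block_mx (diag_mx s) 0 (- diag_mx r) 1%:M) = \det (diag_mx s).
    rewrite mulmx_block !mulmx1 !mulmx0 !mulmxN !add0r psqr.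
    by rewrite (diagC s) subrr det_ublock det1 mul1r.
  rewrite det_mulmx det_lblock det1 mulr1 -[RHS]mul1r; apply: mulIf.
  by rewrite det_diag; apply/prodf_neq0.
rewrite /Lambda_pol /Delta_pol; set e := \row_i _.
rewrite tr_block_mx !mulmx_block !tr_diag_mx !mulmx0 !(add0r, addr0) !mulmxN.
rewrite !mulNmx.
have comm3 (a b : 'rV[int]_g) :
    diag_mx a *m diag_mx e *m diag_mx b = diag_mx e *m (diag_mx a *m diag_mx b).
  by rewrite (diagC a) mulmxA.
rewrite !comm3 (diagC q p) (diagC s r) (diagC s p) (diagC r q) !addNr.
rewrite [- _ + _]addrC -mulmxBr psqr mulmx1.
by rewrite addrC -opprB -mulmxBr psqr mulmx1.
Qed.

(** * Reduction inside each coordinate plane *)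

(** The first column holds Bezout coefficients, the second is (-y/gcd, x/gcd). The hypothesis makes
    s = x/gcd nonzero, except for x = y = 0, where the identity serves. *)
Lemma SL2_gcd (x y : int) : (x != 0) || (y == 0) ->
  {m : (int * int) * (int * int) |
    let: ((p, q), (r, s)) := m in
    [/\ s != 0, p * s - q * r = 1, x * p + y * r = gcdz x y & x * q + y * s = 0]}.
Proof.
have [-> /eqP -> | x_neq0 _] := eqVneq x 0.
  by exists ((1, 0), (0, 1)).
have g_neq0 : gcdz x y != 0 by rewrite gcdz_eq0 (negPf x_neq0).
have /esym def_x := divzK (dvdz_gcdl x y).
have /esym def_y := divzK (dvdz_gcdr x y).
move: (_ %/ _)%Z (_ %/ _)%Z def_x def_y => y' x' def_x def_y.
have [u [v def_g]] := Bezoutz x y.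
exists ((u, - y'), (v, x')); split.
- by apply: contraNneq x_neq0 => x'0; rewrite def_x x'0 mul0r.
- apply: (mulIf g_neq0); rewrite mul1r mulNr opprK mulrDl -mulrA -def_x.
  by rewrite -mulrA mulrCA -def_y.
- by rewrite ![_ * u]mulrC ![_ * v]mulrC.
- apply/eqP; rewrite mulrN addrC subr_eq0 [in X in X == _]def_y.
  by rewrite [in X in _ == X]def_x mulrAC [y' * x']mulrC mulrAC.
Qed.

Definition nat_vec (g : nat) (x : 'I_g -> nat) : 'rV[int]_(g + g) :=
  row_mx (\row_i (x i)%:Z) 0.

Lemma eq_nat_vec g (x x' : 'I_g -> nat) : x =1 x' -> nat_vec x = nat_vec x'.
Proof. by move=> eqx; congr row_mx; apply/rowP=> i; rewrite !mxE eqx. Qed.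

Lemma same_orbit_gcd g d (x y : 'rV[int]_g) :
  same_orbit d (row_mx x y) (nat_vec (fun i => gcdn `|x 0 i| `|y 0 i|)).
Proof.
(* Adding y_i to x_i exactly where x_i = 0 keeps the gcd and secures the hypothesis of [SL2_gcd]. *)
pose C := diag_mx (\row_i ((x 0 i == 0)%:R : int)).
pose x1 := x + y *m C.
have x1E i : x1 0 i = x 0 i + (x 0 i == 0)%:R * y 0 i.
  by rewrite /x1 mxE mul_mx_diag !mxE mulrC.
apply: same_orbit_trans (_ : same_orbit d _ (row_mx x1 y)) _.
  by apply: same_orbit_lblock; rewrite /Delta_pol mulmx_diag tr_diag_mx.
clearbody x1.
have x1_ok i : (x1 0 i != 0) || (y 0 i == 0).
  by rewrite x1E; case: (eqVneq (x 0 i) 0) => [->|xi0];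
    rewrite ?add0r ?mul1r ?orNb // mul0r addr0 xi0.
pose m i := sval (SL2_gcd (x1_ok i)).
have mP i : [/\ (m i).2.2 != 0, (m i).1.1 * (m i).2.2 - (m i).1.2 * (m i).2.1 = 1,
    x1 0 i * (m i).1.1 + y 0 i * (m i).2.1 = gcdz (x1 0 i) (y 0 i)
  & x1 0 i * (m i).1.2 + y 0 i * (m i).2.2 = 0].
  by rewrite /m; case: (SL2_gcd _) => [[[p q] [r s]]].
have := @same_orbit_diag_block g d x1 y (\row_i (m i).1.1) (\row_i (m i).1.2)
  (\row_i (m i).2.1) (\row_i (m i).2.2).
set w := row_mx (\row_i _) _ => orb_w.
suff <- : w = nat_vec (fun i => gcdn `|x 0 i| `|y 0 i|).
  by apply: orb_w => i; rewrite !mxE; case: (mP i).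
congr row_mx; apply/rowP=> i; rewrite !mxE; have [_ _ xy_g xy_0] := mP i; last exact: xy_0.
rewrite xy_g.
congr (Posz _); rewrite x1E; case: (eqVneq (x 0 i) 0) => [->|_].
  by rewrite add0r mul1r gcdnn gcd0n.
by rewrite mul0r addr0.
Qed.

Lemma prod_range_gt0 d i j :
  (forall k, (i <= k <= j)%N -> (0 < d k)%N) -> (0 < prod_range d i j)%N.
Proof.
move=> d_gt0; rewrite /prod_range big_seq prodn_cond_gt0 // => k.
by rewrite mem_index_iota ltnS; apply: d_gt0.
Qed.

Lemma prod_range_split d i j k : (i <= j.+1)%N -> (j <= k)%N ->
  prod_range d i k = (prod_range d i j * prod_range d j.+1 k)%N.
Proof. by move=> ij jk; rewrite /prod_range (big_cat_nat _ (n := j.+1)). Qed.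

(* With [B = E_ij + r E_ji], where [r] is the quotient of the j-th by the     *)
(* i-th polarisation degree, [x] is kept and the y-part becomes [x_i] in      *)
(* position [j] and [r x_j] in position [i].                                  *)
Lemma same_orbit_pair g d (x : 'I_g -> nat) (i j : 'I_g) : (i < j)%N ->
  same_orbit d (nat_vec x)
    (nat_vec (fun k => if k == i then gcdn (x i) (prod_range d i.+1 j * x j)
                       else if k == j then gcdn (x i) (x j) else x k)).
Proof.
move=> lt_ij; set r := prod_range d i.+1 j.
have neq_ij : i != j by rewrite neq_ltn lt_ij.
pose X : 'rV[int]_g := \row_k (x k)%:Z.
pose B : 'M[int]_g := delta_mx i j + r%:Z *: delta_mx j i.
have XB : X *m B = \row_k (if k == i then (r * x j)%N%:Z else
                           if k == j then (x i)%:Z else 0).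
  rewrite mulmxDr -scalemxAr -(mul_delta_mx (0 : 'I_1) i) -(mul_delta_mx (0 : 'I_1) j) !mulmxA -!colE.
  apply/rowP=> k; rewrite !mxE !big_ord1 !mxE !eqxx /=.
  case: (eqVneq k i) => [->|_]; first by
    rewrite (negPf neq_ij) mulr0 add0r mulr1 PoszM.
  by case: (k == j); rewrite ?(mulr0, mulr1, addr0).
apply: same_orbit_trans (_ : same_orbit d _ (row_mx X (X *m B + 0))) _.
  apply: same_orbit_ublock; rewrite mul_mx_diag.
  have Delta_j : prod_range d 1 j = (prod_range d 1 i * r)%N.
    by rewrite (@prod_range_split d 1 i j) // ltnW.
  apply/matrixP=> k l; rewrite !mxE.
  case: (eqVneq k i) => [-> | _]; last first.
    case: (eqVneq l i) => [-> | _].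
      rewrite (negPf neq_ij); case: (eqVneq k j) => [-> /= | _ /=].
        by rewrite Delta_j mulr0 add0r addr0 mulr1 mul1r PoszM mulrC.
      by rewrite !(mulr0, addr0, mul0r).
    by rewrite andbF /= !(mulr0, addr0, mul0r) andbF !(mulr0, addr0, mul0r).
  rewrite (negPf neq_ij) /= andbF andbT add0r mulr0 addr0.
  case: (eqVneq l j) => [-> | _]; last by rewrite mulr0 !mul0r.
  by rewrite Delta_j PoszM mulr1 mul1r mulrC.
rewrite addr0 XB; set Y := \row_k _.
have := same_orbit_gcd d X Y; congr same_orbit; apply: eq_nat_vec => k.
rewrite !mxE; case: (eqVneq k i) => [->|_] //; case: (eqVneq k j) => [->|_].
  by rewrite gcdnC.
by rewrite gcdn0.
Qed.

(** * Descent to balanced vectors *)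

(** These are exactly the vectors that no move of [same_orbit_pair] changes. *)
Definition balanced (g : nat) (d : nat -> nat) (x : 'I_g -> nat) : Prop :=
  forall i j : 'I_g, (i < j)%N ->
    (x j %| x i)%N /\ (x i %| prod_range d i.+1 j * x j)%N.

Section PositiveType.
Variables (g : nat) (d : nat -> nat).
Hypothesis d_gt0 : forall i : nat, (1 <= i < g)%N -> (0 < d i)%N.

Lemma prod_range_ord_gt0 (i j : 'I_g) : (0 < prod_range d i.+1 j)%N.
Proof.
apply: prod_range_gt0 => k /andP[lt_ik le_kj]; apply: d_gt0.
by rewrite (leq_ltn_trans _ lt_ik) // (leq_ltn_trans le_kj).
Qed.

(** If x_j = 0, one pair move with k makes entry j equal to x_k or to a positive multiple of it, and
    every gcd formed involves x_k, so no positive entry is lost. *)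
Lemma same_orbit_spread (x : 'I_g -> nat) (k j : 'I_g) : (0 < x k)%N ->
  exists2 x', same_orbit d (nat_vec x) (nat_vec x') &
    (0 < x' j)%N /\ forall l, (0 < x l)%N -> (0 < x' l)%N.
Proof.
move=> xk_gt0; wlog: / (x j == 0)%N.
  have [xj0 | xj_gt0] := posnP (x j); first by apply.
  by move=> _; exists x => //; exact: same_orbit_refl.
move=> /eqP xj0; have := neq_ltn k j.
have -> : k != j by apply: contraTneq xk_gt0 => ->; rewrite xj0.
move/esym/orP=> [lt_kj | lt_jk].
  exists (fun l => if l == k then gcdn (x k) (prod_range d k.+1 j * x j)
                   else if l == j then gcdn (x k) (x j) else x l).
    exact: same_orbit_pair.
  split=> [|l xl]; rewrite ?eqxx; repeat case: ifP => _ //;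
    by rewrite gcdn_gt0 xk_gt0.
exists (fun l => if l == j then gcdn (x j) (prod_range d j.+1 k * x k)
                 else if l == k then gcdn (x j) (x k) else x l).
  exact: same_orbit_pair.
split=> [|l xl]; rewrite ?eqxx; repeat case: ifP => _ //;
  by rewrite gcdn_gt0 ?muln_gt0 ?prod_range_ord_gt0 xk_gt0 orbT.
Qed.

Lemma same_orbit_pos (x : 'I_g -> nat) (k : 'I_g) : (0 < x k)%N ->
  exists2 x', same_orbit d (nat_vec x) (nat_vec x') & forall i, (0 < x' i)%N.
Proof.
move=> xk_gt0.
suff [x' orb [_ x'_gt0]] : exists2 x', same_orbit d (nat_vec x) (nat_vec x') &
    (0 < x' k)%N /\ {in enum 'I_g, forall i, 0 < x' i}%N.
  by exists x' => // i; rewrite x'_gt0 ?mem_enum.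
elim: (enum _) => [|j s [x' orb [x'k_gt0 x's]]].
  by exists x; [exact: same_orbit_refl | split].
have [x2 orb2 [x2j x2_gt0]] := same_orbit_spread j x'k_gt0.
exists x2; first exact: same_orbit_trans orb orb2.
split=> [|i]; first exact: x2_gt0.
by rewrite inE => /predU1P[-> // | /x's]; apply: x2_gt0.
Qed.

(** Induction on the sum of the entries: a pair move replaces entries by divisors, which are no
    larger because the entries are positive. *)
Lemma same_orbit_balanced (x : 'I_g -> nat) : (forall i, 0 < x i)%N ->
  exists x', [/\ same_orbit d (nat_vec x) (nat_vec x'),
                 forall i, (0 < x' i)%N & balanced d x'].
Proof.
have [n] := ubnP (\sum_i x i)%N; elim: n => // n IHn in x * => lt_x_n x_gt0.
case: (pickP (fun ij : 'I_g * 'I_g => (ij.1 < ij.2)%N &&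
  ~~ ((x ij.2 %| x ij.1) && (x ij.1 %| prod_range d ij.1.+1 ij.2 * x ij.2))%N))
  => [[i j] /= /andP[lt_ij unbal] | bal]; last first.
  exists x; split=> [||i j lt_ij]; [exact: same_orbit_refl | by [] |].
  by have := bal (i, j); rewrite /= lt_ij /= => /negbFE/andP.
have orb := same_orbit_pair d x lt_ij; move: orb.
set x' := (fun k => _) => orb.
have x'_gt0 k : (0 < x' k)%N.
  by rewrite /x'; repeat case: ifP => _ //; rewrite gcdn_gt0 x_gt0.
have le_x' k : (x' k <= x k)%N.
  rewrite /x'; case: eqP => [->|_]; first by rewrite dvdn_leq ?dvdn_gcdl.
  by case: eqP => [->|_] //; rewrite dvdn_leq ?dvdn_gcdr.
have lt_sum : (\sum_k x' k < \sum_k x k)%N.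
  (* If the sum did not drop, every entry would be unchanged; at i and j this is the balance
     condition. *)
  rewrite (ltn_leqif (leqif_sum (fun k _ => leqif_eq (le_x' k)))).
  apply: contra unbal => /forallP eq_x.
  have /eqP <- := eq_x j; have /eqP := eq_x i.
  have neq_ji : (j == i) = false.
    by apply/negbTE; rewrite neq_ltn lt_ij orbT.
  rewrite /x' neq_ji !eqxx => xi; rewrite dvdn_gcdl /=.
  have /eqP := eq_x j; rewrite /x' neq_ji eqxx => ->.
  by rewrite -{1}xi dvdn_gcdr.
have [||x2 [orb2 x2_gt0 x2_bal]] := IHn x' => //.
  exact: leq_trans lt_sum _.
by exists x2; split=> //; exact: same_orbit_trans orb orb2.
Qed.

(** * The obstruction that separates orbits *)

(** Let A be the upper left block of M and D' the lower right block of its inverse, which is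
    integral. The lower left blocks of M^-1 Lambda = Lambda M^T give D' Delta = Delta A^T, that is,
    D'_{ik} delta_k = delta_i A_{ki}. *)
Lemma Gamma_pol_ul_dvd (M : 'M[int]_(g + g)) (i k : 'I_g) :
  Gamma_pol d M -> (i < k)%N -> ((prod_range d i.+1 k)%:Z %| ulsubmx M k i)%Z.
Proof.
move=> GM lt_ik; have uM := Gamma_pol_unitmx GM; case: GM => _ sM.
have : invmx M *m Lambda_pol g d = Lambda_pol g d *m M^T.
  by rewrite -[in LHS]sM -!mulmxA mulKmx.
rewrite -[invmx M]submxK -[in M^T](submxK M) /Lambda_pol tr_block_mx.
rewrite !mulmx_block !(mul0mx, mulmx0, add0r, addr0) !(mulNmx, mulmxN).
case/eq_block_mx=> _ _ /eqP; rewrite eqr_opp => /eqP.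
rewrite mul_mx_diag mul_diag_mx => /matrixP/(_ i k).
rewrite !mxE => eq_ik _.
have e1_neq0 : (prod_range d 1 i)%:Z != 0.
  rewrite eqz_nat -lt0n prod_range_gt0 // => n /andP[n_gt0 le_ni].
  by rewrite d_gt0 // n_gt0 (leq_ltn_trans le_ni).
rewrite -(dvdz_mul2l e1_neq0) -PoszM -prod_range_split // 1?ltnW //.
by rewrite -eq_ik dvdz_mull.
Qed.

End PositiveType.

(** In x'_i = sum_k x_k A_{ki}, each term is a multiple of x_i: for k < i because x_i | x_k, for k >
    i because A_{ki} is a multiple of r = d_{i+1:k} (ordinal indices) and x_i | r x_k. *)
Lemma balanced_orbit_dvd g d (d_gt0 : forall i, (1 <= i < g)%N -> (0 < d i)%N)
    (x x' : 'I_g -> nat) :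
  balanced d x -> same_orbit d (nat_vec x) (nat_vec x') ->
  forall i, (x i %| x' i)%N.
Proof.
move=> x_bal [M GM]; rewrite /nat_vec.
set X := \row_i (x i)%:Z; set X' := \row_i (x' i)%:Z.
rewrite -(submxK M) mul_row_block !mul0mx !addr0 => /eq_row_mx[eqX' _] i.
move/rowP/(_ i): eqX'; rewrite !mxE => x'_i.
rewrite -[(_ %| _)%N]/((x i)%:Z %| (x' i)%:Z)%Z x'_i.
apply: rpred_sum => k _; rewrite mxE.
case: (ltngtP k i) => [lt_ki | lt_ik | /val_inj ->]; last exact: dvdz_mulr.
  by have [+ _] := x_bal _ _ lt_ki; move=> dv; apply: dvdz_mulr.
have [_ dv] := x_bal _ _ lt_ik.
apply: (@dvdz_trans ((prod_range d i.+1 k * x k)%N%:Z)) => //.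
by rewrite PoszM mulrC dvdz_mul // Gamma_pol_ul_dvd.
Qed.

(** * Divisibility chains and admissible pairs *)

(** Conditions on neighbours telescope to all pairs of indices. *)
Lemma chain_dvd g (d t : nat -> nat) :
    (forall i, (1 <= i < g)%N -> (t i.+1 %| t i)%N /\ (t i %| d i * t i.+1)%N) ->
  forall i j, (1 <= i <= j)%N -> (j <= g)%N ->
    (t j %| t i)%N /\ (t i %| prod_range d i j.-1 * t j)%N.
Proof.
move=> tP i j /andP[i_gt0 le_ij]; rewrite -(subnKC le_ij).
elim: (j - i)%N => {j le_ij} [_|m IHm lt_g].
  by rewrite addn0 /prod_range prednK // big_geq // mul1n dvdnn.
rewrite addnS in lt_g *; have [t1 t2] := IHm (ltnW lt_g).
have im_gt0 : (0 < i + m)%N by rewrite addn_gt0 i_gt0.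
have [|u1 u2] := tP (i + m)%N; first by rewrite im_gt0.
split; first exact: dvdn_trans u1 t1.
apply: dvdn_trans t2 _; rewrite /= (@prod_range_split d i (i + m).-1 (i + m)).
- rewrite prednK // -mulnA dvdn_mul // /prod_range big_nat1 //.
- by rewrite prednK // leq_addr.
- exact: leq_pred.
Qed.

Lemma balanced_chain g (d t : nat -> nat) :
    (forall i, (1 <= i < g)%N -> (t i.+1 %| t i)%N /\ (t i %| d i * t i.+1)%N) ->
  balanced d (fun i : 'I_g => t i.+1).
Proof.
move=> tP i j lt_ij.
by have := @chain_dvd g d t tP i.+1 j.+1; apply; rewrite //= ltnS ltnW.
Qed.

Lemma prod_range_recl D i j : (i <= j)%N ->
  prod_range D i j = (D i * prod_range D i.+1 j)%N.
Proof. by move=> le_ij; rewrite /prod_range big_ltn. Qed.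

Lemma prod_range_empty D i j : (j < i)%N -> prod_range D i j = 1%N.
Proof. by move=> lt_ji; rewrite /prod_range big_geq. Qed.

Section Admissible.
Variables (g : nat) (d : nat -> nat).

(** After cancelling common factors the claims are a_{i+1} | D_i a_i and a_i | (d_i/D_i) a_{i+1};
    the end cases follow from a_g = 1 and a_1 = 1. *)
Lemma admissible_chain D a : admissible g d D a ->
  forall i, (1 <= i < g)%N ->
    let t i := (prod_range D i g.-1 * a i)%N in
    (t i.+1 %| t i)%N /\ (t i %| d i * t i.+1)%N.
Proof.
move=> [D_d _ [a1 ag] a_dvd] i /andP[i_gt0 lt_ig] /=.
have le_ig : (i <= g.-1)%N by rewrite -ltnS (ltn_predK lt_ig).
have [|Di_gt0 /dvdnP[e def_d]] := D_d i; first by rewrite i_gt0.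
rewrite (prod_range_recl D le_ig) def_d; split.
  rewrite mulnAC mulnC dvdn_mul //.
  have [-> | lt_i1g] : i.+1 = g \/ (i.+1 < g)%N.
    by apply/predU1P; rewrite -leq_eqVlt.
    by rewrite ag dvd1n.
  by have := a_dvd i.+1; rewrite lt_i1g andbT ltnS i_gt0 dvdn_gcd => /(_ isT)/andP[].
rewrite [(e * D i)%N]mulnC -!mulnA dvdn_mul // mulnCA dvdn_mul //.
have [-> | i_neq1] := eqVneq i 1%N; first by rewrite a1 dvd1n.
have := a_dvd i; rewrite lt_ig ltn_neqAle eq_sym i_neq1 i_gt0 => /(_ isT).
by rewrite dvdn_gcd def_d mulnK // => /andP[].
Qed.

(** D_i factors out of both arguments, and d_i/D_i is coprime to every later D_j. *)
Lemma admissible_gcd D a i : admissible g d D a -> (1 <= i < g)%N ->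
  gcdn (d i) (prod_range D i g.-1) = D i.
Proof.
move=> [D_d co_D _ _] /andP[i_gt0 lt_ig].
have le_ig : (i <= g.-1)%N by rewrite -ltnS (ltn_predK lt_ig).
have [|Di_gt0 D_dvd] := D_d i; first by rewrite i_gt0.
rewrite prod_range_recl // -{1}(divnK D_dvd) mulnC -muln_gcdr.
rewrite [X in (_ * X)%N](_ : _ = 1%N) ?muln1 //; apply/eqP.
rewrite -[_ == _]/(coprime _ _) /prod_range big_seq_cond.
elim/big_rec: _ => [|k P]; first exact: coprimen1.
rewrite andbT mem_index_iota (ltn_predK lt_ig) => /andP[lt_ik lt_kg] co_P.
by rewrite coprimeMr co_P andbT; apply/eqP/co_D.
Qed.

(** As a_1 = 1, the first products D_{1:g-1} agree; [admissible_gcd] then peels off D_1, D_2, ... in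
    turn, and dividing by D_{i:g-1} recovers a_i. *)
Lemma admissible_inj D a D' a' : admissible g d D a -> admissible g d D' a' ->
    (forall i, (1 <= i <= g)%N ->
       prod_range D i g.-1 * a i = prod_range D' i g.-1 * a' i)%N ->
  forall i, (1 <= i < g)%N -> D i = D' i /\ a i = a' i.
Proof.
move=> adm adm' eq_t.
have eq_P i : (0 < i <= g)%N -> prod_range D i g.-1 = prod_range D' i g.-1.
  case: i => // i; elim: i => [|i IHi] /= lt_ig.
    have [_ _ [a1 _] _] := adm; have [_ _ [a1' _] _] := adm'.
    by have := eq_t 1%N lt_ig; rewrite a1 a1' !muln1.
  have eqP := IHi (ltnW lt_ig).
  have eqD : D i.+1 = D' i.+1.
    by rewrite -(admissible_gcd adm) // -(admissible_gcd adm') // eqP.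
  have le_ig : (i.+1 <= g.-1)%N by rewrite -ltnS (ltn_predK lt_ig).
  move: eqP; rewrite !(prod_range_recl _ le_ig) eqD => /eqP.
  have [/(_ i.+1 lt_ig)[D'_gt0 _] _ _ _] := adm'.
  by rewrite eqn_pmul2l // => /eqP.
move=> i /andP[i_gt0 lt_ig].
have i_g : (0 < i <= g)%N by rewrite i_gt0 ltnW.
split.
  by rewrite -(admissible_gcd adm) -?(admissible_gcd adm') ?i_gt0 // eq_P.
apply/eqP; rewrite -(@eqn_pmul2l (prod_range D i g.-1)).
  by rewrite eq_t // eq_P.
rewrite prod_range_gt0 // => k /andP[le_ik le_kg].
have [D_d _ _ _] := adm; case: (D_d k) => //.
by rewrite (leq_trans i_gt0 le_ik) -(ltn_predK lt_ig) ltnS.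
Qed.

(* [D_tail t0 (i - 1)] is D_{i:g-1}, given its value [t0] = D_{1:g-1}.         *)
Fixpoint D_tail (t0 : nat) (i : nat) : nat :=
  if i is j.+1 then (D_tail t0 j %/ gcdn (d i) (D_tail t0 j))%N else t0.

(** Greedy choice: P_1 = t_1, D_i = gcd(d_i, P_i), P_{i+1} = P_i/D_i and a_i = t_i/P_i. The point is
    that P_i | t_i. *)
Lemma admissible_exists (t : nat -> nat) : (0 < g)%N ->
    (forall i, (1 <= i <= g)%N -> 0 < t i)%N -> t g = 1%N ->
    (forall i, (1 <= i < g)%N -> (t i.+1 %| t i)%N /\ (t i %| d i * t i.+1)%N) ->
    (forall i, (1 <= i < g)%N -> (0 < d i)%N) ->
  exists D a, admissible g d D a /\
    forall i, (1 <= i <= g)%N -> (prod_range D i g.-1 * a i)%N = t i.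
Proof.
move=> g_gt0 t_gt0 tg tP d_gt0.
pose P i := D_tail (t 1%N) i.-1; pose D i := gcdn (d i) (P i).
pose a i := (t i %/ P i)%N.
have P_S i : (0 < i)%N -> P i.+1 = (P i %/ D i)%N by case: i.
have D_P i : (D i %| P i)%N by exact: dvdn_gcdr.
have P_t i : (0 < i <= g)%N -> (P i %| t i)%N.
  case: i => // i; elim: i => [|i IHi] /= lt_ig; first exact: dvdnn.
  (* Divide P_i | d_i t_{i+1} by D_i: P_{i+1} divides (d_i/D_i) t_{i+1} and is coprime to d_i/D_i,
     so Gauss applies. *)
  have [_ t_dvd] := tP i.+1 lt_ig; have dvP := dvdn_trans (IHi (ltnW lt_ig)) t_dvd.
  have D_gt0 : (0 < D i.+1)%N by rewrite gcdn_gt0 d_gt0.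
  rewrite P_S // -(Gauss_dvdr _ (_ : coprime _ (d i.+1 %/ D i.+1)%N)).
    rewrite -(dvdn_pmul2l D_gt0) mulnA ![(D _ * (_ %/ _))%N]mulnC !divnK //.
    exact: dvdn_gcdl.
  rewrite /coprime -(eqn_pmul2l D_gt0) muln1 muln_gcdr.
  by rewrite ![(D _ * (_ %/ _))%N]mulnC !divnK // ?dvdn_gcdl // gcdnC.
have P_gt0 i : (0 < i <= g)%N -> (0 < P i)%N.
  by move=> i_g; rewrite (dvdn_gt0 (t_gt0 i i_g)) // P_t.
have P_D i : (0 < i <= g)%N -> P i = (D i * P i.+1)%N.
  by case/andP=> i_gt0 _; rewrite P_S // mulnC divnK.
(* This terminal value is what identifies P_i with D_{i:g-1}. *)
have Pg : P g = 1%N.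
  by apply/eqP; rewrite -dvdn1 -tg P_t // g_gt0 leqnn.
have prodD i : (0 < i <= g)%N -> prod_range D i g.-1 = P i.
  move=> /andP[+ le_ig]; rewrite -(subKn le_ig).
  elim: (g - i)%N (leq_subr i g) => {i le_ig} [_ _ | m IHm lt_mg gm_gt0].
    by rewrite subn0 prod_range_empty ?prednK.
  have eq_gm : (g - m)%N = (g - m.+1).+1 by rewrite subnSK.
  rewrite prod_range_recl; last by rewrite -subn1 leq_sub2l.
  by rewrite -eq_gm IHm ?(ltnW lt_mg) ?eq_gm // -P_D // gm_gt0 leq_subr.
have P_a i : (0 < i <= g)%N -> (P i * a i)%N = t i.
  by move=> i_g; rewrite mulnC divnK ?P_t.
exists D, a; split=> [|i i_g]; last by rewrite prodD ?P_a.
split.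
- move=> i i_g; split; first by rewrite gcdn_gt0 d_gt0.
  exact: dvdn_gcdl.
- move=> i j i_gt0 lt_ij lt_jg.
  have i_g : (0 < i <= g)%N by rewrite i_gt0 ltnW // (ltn_trans lt_ij).
  have D_gt0 : (0 < D i)%N by rewrite gcdn_gt0 d_gt0 ?i_gt0 ?(ltn_trans lt_ij).
  (* D_j | P_j | P_{i+1}, and P_{i+1} is coprime to d_i/D_i. *)
  have P_mono k : (P (i.+1 + k)%N %| P i.+1)%N.
    elim: k => [|k IHk]; first by rewrite addn0.
    by rewrite addnS P_S // (dvdn_trans _ IHk) // dvdn_div.
  apply/eqP; apply: (@coprime_dvdr _ (P i.+1)).
    by rewrite (dvdn_trans (D_P j)) // -(subnKC lt_ij) P_mono.
  rewrite /coprime -(eqn_pmul2l D_gt0) muln1 muln_gcdr -P_D //.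
  by rewrite mulnC divnK // dvdn_gcdl.
- rewrite /a tg Pg divn1 /P /= divnn; split=> //.
  by rewrite t_gt0.
move=> i /andP[i_gt1 lt_ig]; have i_gt0 := ltnW i_gt1.
have i_g : (0 < i <= g)%N by rewrite i_gt0 ltnW.
have i'_gt0 : (0 < i.-1)%N by rewrite -ltnS (ltn_predK i_gt1).
have i'_g : (0 < i.-1 < g)%N.
  by rewrite i'_gt0 (leq_ltn_trans (leq_pred i)).
have D_gt0 : (0 < D i)%N by rewrite gcdn_gt0 d_gt0 ?i_gt0.
have [+ _] := tP _ i'_g; rewrite (ltn_predK i_gt1) => dv1.
have [_ dv2] := tP i (introT andP (conj i_gt0 lt_ig)).
have dvd_P := dvdn_pmul2l (P_gt0 _ i_g).
(* Multiplied by P_i, the two conditions become t_i | t_{i-1} and t_i | d_i t_{i+1}. *)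
rewrite dvdn_gcd; apply/andP; split; rewrite -dvd_P P_a //.
  have i'_leg : (0 < i.-1 <= g)%N by rewrite i'_gt0 ltnW //; case/andP: i'_g.
  have := P_D _ i'_leg; rewrite (ltn_predK i_gt1) => P_pred.
  by rewrite mulnA [(P i * _)%N]mulnC -P_pred P_a.
rewrite P_D // mulnACA [(D i * _)%N]mulnC divnK ?dvdn_gcdl //.
by rewrite P_a.
Qed.

End Admissible.

(** * Orbits of primitive vectors and their representatives *)

Lemma hat_vec_nat_vec g D a :
  hat_vec g D a = nat_vec (fun i : 'I_g => prod_range D i.+1 g.-1 * a i.+1)%N.
Proof. by []. Qed.

Lemma dvd_primitive_vec n (v : 'rV[int]_n) (m : nat) : primitive_vec v ->
  (forall j, (m %| `|v 0%R j|)%N) -> m = 1%N.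
Proof.
by move=> v_prim m_v; apply/eqP; rewrite -dvdn1 -v_prim; apply/dvdn_biggcdP.
Qed.

Theorem corollary4p6 (g : nat) (d : nat -> nat)
    (g_gt0 : (0 < g)%N)
    (d_gt0 : forall i : nat, (1 <= i < g)%N -> (0 < d i)%N) :
  [/\ forall D a : nat -> nat,
        admissible g d D a -> primitive_vec (hat_vec g D a),
      forall v : 'rV[int]_(g + g), primitive_vec v ->
        exists D a : nat -> nat,
          admissible g d D a /\ same_orbit d v (hat_vec g D a)
    & forall D a D' a' : nat -> nat,
        admissible g d D a -> admissible g d D' a' ->
        same_orbit d (hat_vec g D a) (hat_vec g D' a') ->
        forall i : nat, (1 <= i < g)%N -> D i = D' i /\ a i = a' i].
Proof.
have lt_pred_g : (g.-1 < g)%N by rewrite prednK.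
pose last := Ordinal lt_pred_g.
split=> [D a [_ _ [_ ag] _] | v v_prim | D a D' a' adm adm' orb].
- apply/eqP; rewrite -dvdn1; apply: (biggcdn_inf (lshift g last)) => //.
  by rewrite row_mxEl mxE /= prednK // ag prod_range_empty ?prednK.
- pose x i := gcdn `|lsubmx v 0 i| `|rsubmx v 0 i|.
  have orb_x : same_orbit d v (nat_vec x).
    by rewrite -{1}(hsubmxK v); apply: same_orbit_gcd.
  have [k xk_gt0] : exists k, (0 < x k)%N.
    apply/existsP; rewrite -[[exists _, _]]negbK negb_exists.
    apply/negP=> /forallP x0.
    suff : 0%N = 1%N by [].
    apply: dvd_primitive_vec v_prim _ => j.
    have {}x0 i : (lsubmx v 0 i == 0) && (rsubmx v 0 i == 0).
      by have := x0 i; rewrite gcdn_gt0 negb_or -!eqn0Ngt !absz_eq0.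
    rewrite -[v]hsubmxK mxE; case: (split j) => i;
    by have /andP[/eqP e1 /eqP e2] := x0 i; rewrite ?e1 ?e2.
  have [y orb_y y_gt0] := same_orbit_pos d_gt0 xk_gt0.
  have [z [orb_z z_gt0 z_bal]] := same_orbit_balanced d y_gt0.
  have orb : same_orbit d v (nat_vec z).
    exact: same_orbit_trans orb_x (same_orbit_trans orb_y orb_z).
  have last_dvd i : (z last %| z i)%N.
    have [/z_bal[] // | ge_i] := ltnP i last.
    suff -> : i = last by [].
    by apply/val_inj/eqP; rewrite eqn_leq ge_i -ltnS prednK ?ltn_ord.
  (* The last entry divides all of z, hence every entry of v, an integral image of z; but v is
     primitive. *)
  have z_last : z last = 1%N.
    apply: dvd_primitive_vec v_prim _ => j.
    have [M _ ->] := same_orbit_sym orb; rewrite mxE.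
    rewrite -[(_ %| _)%N]/((z last)%:Z %| _)%Z.
    apply: rpred_sum => l _; apply: dvdz_mulr.
    by rewrite mxE; case: (split l) => i; rewrite mxE //; apply: last_dvd.
  (* Shifts the indices to start at 1; the default 1 is taken only for i > g. *)
  pose t i := if insub i.-1 is Some o then z o else 1%N.
  have tE (i : 'I_g) : t i.+1 = z i by rewrite /t /= valK.
  have [|||||D [a [adm Da]]] := @admissible_exists g d t.
  + by [].
  + by move=> [//|i] lt_ig; rewrite (tE (Ordinal lt_ig)).
  + by rewrite -(prednK g_gt0) (tE last).
  + move=> [//|i] /= lt_ig; have lt_ig' := ltnW lt_ig.
    rewrite (tE (Ordinal lt_ig)) (tE (Ordinal lt_ig')).
    have := z_bal (Ordinal lt_ig') (Ordinal lt_ig) (ltnSn _).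
    by rewrite /prod_range /= big_nat1.
  + by [].
  exists D, a; split=> //; rewrite hat_vec_nat_vec.
  rewrite (@eq_nat_vec _ _ z) // => i.
  by rewrite Da; [exact: tE | exact: ltn_ord].
(* Both vectors are balanced, so their entries divide each other. *)
apply: (admissible_inj adm adm') => -[//|i] lt_ig; apply/eqP.
rewrite eqn_dvd; move: orb; rewrite !hat_vec_nat_vec => orb.
have bal := balanced_chain (admissible_chain adm).
have bal' := balanced_chain (admissible_chain adm').
rewrite (balanced_orbit_dvd d_gt0 bal orb (Ordinal lt_ig)).
exact: (balanced_orbit_dvd d_gt0 bal' (same_orbit_sym orb) (Ordinal lt_ig)).
Qed.
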